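(* Let $P$ be a positively skewed probability distribution on the real line. (i) If $P$ is unimodal with mode $m_0$, then there exists a median $m_1$ of $P$ such that $m_0\le m_1$. (ii) If $P$ has finite mean $m_2$, then there exists a median $m_1$ of $P$ such that $m_1\le m_2$. (iii) If $P$ is uniantimodal with anti-mode $m_3$, then there exists a median $m_1$ of $P$ such that $m_1\le m_3$.
   Context: Convex transform order $\le_c$: let $X\sim P$ and $Y\sim Q$, where $P$ and $Q$ are probability distributions on the real line supported by intervals $I$ and $J$ with strictly increasing distribution functions $F\colon I\to[0,1]$ and $G\colon J\to[0,1]$. Then $X\le_c Y$ means that the mapping $x\mapsto G^{-1}(F(x))$ is convex on $I$; in particular $G^{-1}(F(x))$ must be defined for every $x\in I$, i.e. $F(I)\subseteq G(J)$. A distribution $P$ supported by an interval $I$ is positively skewed if $-X\le_c X$ for $X\sim P$ (where $-X$ is regarded as supported by $-I=\{-x : x\in I\}$). An absolutely continuous distribution $P$ supported by an interval $I$ is unimodal if it has a density that is continuous on $I$ with a unique maximizer in $I$ (the mode), and uniantimodal if it has a density that is continuous on $I$ with a unique minimizer in $I$ (the anti-mode). A median of $P$ is a real number $m$ with $\mathbb{P}(X\le m)\ge1/2$ and $\mathbb{P}(X\ge m)\ge1/2$, where $X\sim P$. *)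

(* Defs.v *)
From HB Require Import structures.
From mathcomp Require Import all_boot all_order all_algebra.
From mathcomp Require Import all_classical all_reals all_analysis.
From mathcomp Require Import measurable_realfun.

Set Implicit Arguments.
Unset Strict Implicit.
Unset Printing Implicit Defensive.

Import Order.TTheory GRing.Theory Num.Theory.
Import numFieldNormedType.Exports.

Local Open Scope classical_set_scope.
Local Open Scope ring_scope.

Notation distr R := (probability (measurableTypeR R) R).

Section DistrRV.
Context {R : realType}.

Definition idR (x : measurableTypeR R) : R := x.

HB.instance Definition _ :=
  @isMeasurableFun.Build _ _ (measurableTypeR R) R idR
    (@measurable_id _ _ setT).

Definition oppR (x : measurableTypeR R) : measurableTypeR R := - (x : R).

Lemma measurable_oppR : measurable_fun [set: measurableTypeR R] oppR.
Proof. exact: (@oppr_measurable R setT). Qed.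

HB.instance Definition _ :=
  @isMeasurableFun.Build _ _ (measurableTypeR R) (measurableTypeR R) oppR
    measurable_oppR.

End DistrRV.

Section Defs.
Context {R : realType}.
Implicit Types (P Q : distr R) (I J : set R) (m : R) (f : R -> R).

Definition distr_fun P : R -> \bar R := cdf (idR : {RV P >-> R}).

(** The distribution of [-X] when [X] has distribution [P]. *)
Definition reflect_distr P : distr R := distribution P oppR.

(** [P] determines such an [I] only up to its endpoints, but the notions below
    depend on whether the endpoints belong to [I] (skewness through
    [F(I) `<=` G(J)], modes through the domain of the maximization), so [I] is
    an explicit parameter of each of them. *)
Definition supported_by P I : Prop :=
  [/\ is_interval I, P I = 1%E
    & {in I &, {homo distr_fun P : x y / x < y >-> (x < y)%E}}].

(** [X <=_c Y] for [X ~ P] supported by [I] and [Y ~ Q] supported by [J].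
    The first conjunct says that the inverse of the distribution function of
    [Q], which is [pinv J (distr_fun Q)] since [distr_fun Q] is injective on
    [J], is evaluated only where it is defined. *)
Definition convex_transform_le P I Q J : Prop :=
  distr_fun P @` I `<=` distr_fun Q @` J /\
  @convex_function R R^o I (fun x => pinv J (distr_fun Q) (distr_fun P x)).

Definition positively_skewed P I : Prop :=
  convex_transform_le (reflect_distr P) [set - x | x in I] P I.

Definition is_density P f : Prop :=
  [/\ measurable_fun [set: measurableTypeR R] (f : measurableTypeR R -> R),
      forall x, 0 <= f x
    & forall A : set (measurableTypeR R), measurable A ->
        P A = (\int[lebesgue_measure]_(x in A) (f x)%:E)%E].

Definition maximizers I f : set R := [set m | I m /\ forall x, I x -> f x <= f m].

Definition minimizers I f : set R := [set m | I m /\ forall x, I x -> f m <= f x].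

Definition unimodal_with_mode P I m : Prop :=
  exists f, [/\ is_density P f, {within I, continuous f}
              & maximizers I f = [set m]].

Definition uniantimodal_with_antimode P I m : Prop :=
  exists f, [/\ is_density P f, {within I, continuous f}
              & minimizers I f = [set m]].

Definition has_finite_mean P m : Prop :=
  P.-integrable setT (EFin \o idR) /\ ('E_P[idR] = m%:E)%E.

Definition is_median P m : Prop :=
  ((2^-1)%:E <= P `]-oo, m]%classic)%E /\ ((2^-1)%:E <= P `[m, +oo[%classic)%E.

End Defs.

(* Main.v *)
(** Put [F x = P(X <= x)] and let [phi x] be the point of [I] with
    [F (phi x) = P(X >= x)], that is, the value at [- x] of the transformation
    defining [-X <=_c X]. Then [phi] is convex on [I], and it is a strictly
    decreasing involution of [I] (also when [P] has atoms). Such an involution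
    has a fixed point [m], which is a median of [P]. The graph of [phi] is
    symmetric about the diagonal, so by convexity it lies above its supporting
    line of slope -1 at [m]: [2 m - x <= phi x]. Hence
    [P(X < m - t) <= P(X > m + t)] for [t >= 0], and integrating over [t]
    gives [m <= m2]. By convexity again, [phi] has slope at least -1 to the right
    of [m]; as it exchanges the masses of [(u, x]] and [(phi x, phi u]], a
    continuous density [f] satisfies [f x <= f (phi x)] for [x > m]. This is
    absurd at [x = m0 > m], and at [x = phi m3] when [m3 < m]. *)

Require Import Defs.
From mathcomp Require Import all_boot all_order all_algebra.
From mathcomp Require Import all_classical all_reals all_analysis.
From mathcomp Require Import measurable_realfun ring lra.

Import Order.TTheory GRing.Theory Num.Theory.
Import numFieldNormedType.Exports.

Local Open Scope classical_set_scope.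
Local Open Scope ring_scope.

(** * Decreasing involutions of an interval, and convex ones *)

Section ConvexInvolution.
Context {R : realType} (I : set R) (phi : R -> R).
Context (itvI : is_interval I) (phiI : forall x, I x -> I (phi x)).
Context (phi_decr : forall x y, I x -> I y -> x < y -> phi y < phi x).
Context (phiK : forall x, I x -> phi (phi x) = x).

(** For every [w] in [I], the smaller of [w] and [phi w] belongs to [S] and the larger bounds [S],
    so [sup S] lies between them. Were [m = sup S] not fixed, the midpoint [w] of [m] and [phi m]
    would have both [w] and [phi w] strictly on the same side of [m]. *)
Lemma decreasing_involution_fixpoint : I !=set0 -> exists m, I m /\ phi m = m.
Proof.
move=> [w0 Iw0].
pose S := [set x | I x /\ x <= phi x].
have minS w : I w -> S (Num.min w (phi w)).
  move=> Iw; rewrite /S /=; case: (leP w (phi w)) => ww; first by [].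
  by split; [exact: phiI | rewrite phiK // ltW].
have maxS w : I w -> ubound S (Num.max w (phi w)).
  move=> Iw s [Is sphi]; rewrite leNgt; apply/negP.
  rewrite gt_max => /andP[ws pws].
  have := phi_decr _ _ Iw Is ws; lra.
have hasS : has_sup S.
  by split; [exists (Num.min w0 (phi w0)); exact: minS
            |exists (Num.max w0 (phi w0)); exact: maxS].
pose m := sup S.
have min_le w : I w -> Num.min w (phi w) <= m.
  by move=> Iw; exact: ub_le_sup (hasS.2) _ (minS _ Iw).
have max_ge w : I w -> m <= Num.max w (phi w).
  by move=> Iw; apply: ge_sup; [exact: hasS.1|exact: maxS].
have Im : I m.
  case: (leP w0 (phi w0)) (min_le _ Iw0) (max_ge _ Iw0) => _ h1 h2.
    by apply: (itvI _ _ Iw0 (phiI _ Iw0)); rewrite h1 h2.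
  by apply: (itvI _ _ (phiI _ Iw0) Iw0); rewrite h1 h2.
exists m; split => //; apply/eqP; rewrite eq_le !leNgt; apply/andP; split.
  apply/negP => mphi; pose w := (m + phi m) / 2.
  have mw : m < w by rewrite /w; lra.
  have wp : w < phi m by rewrite /w; lra.
  have Iw : I w by apply: (itvI _ _ Im (phiI _ Im)); rewrite !ltW.
  have := phi_decr _ _ Iw (phiI _ Im) wp; rewrite phiK // => mpw.
  by have := min_le _ Iw; rewrite leNgt lt_min mw mpw.
apply/negP => mphi; pose w := (m + phi m) / 2.
have mw : w < m by rewrite /w; lra.
have wp : phi m < w by rewrite /w; lra.
have Iw : I w by apply: (itvI _ _ (phiI _ Im) Im); rewrite !ltW.
have := phi_decr _ _ (phiI _ Im) Iw wp; rewrite phiK // => mpw.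
by have := max_ge _ Iw; rewrite leNgt gt_max mw mpw.
Qed.

Context (phi_convex : forall (t x y : R), 0 <= t <= 1 -> I x -> I y ->
  phi (t * x + (1 - t) * y) <= t * phi x + (1 - t) * phi y).
Context (m : R) (Im : I m) (phim : phi m = m).

(** At the midpoint [z] of [x] and [phi x], convexity gives [phi z <= z], because [phi] only swaps
    the two endpoints. This forces [m <= z], since [phi] exceeds [m] to the left of [m]. *)
Lemma convex_involution_ge (x : R) : I x -> 2 * m - x <= phi x.
Proof.
move=> Ix; pose z := 2^-1 * x + (1 - 2^-1) * phi x.
have Iz : I z.
  have [h|h] := leP x (phi x).
    by apply: (itvI _ _ Ix (phiI _ Ix)); rewrite /z; lra.
  by apply: (itvI _ _ (phiI _ Ix) Ix); rewrite /z; lra.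
have : phi z <= z.
  have := phi_convex 2^-1 x (phi x) _ Ix (phiI _ Ix).
  rewrite phiK // -/z => /(_ _); rewrite /z => h.
  by apply: (le_trans (h _)); lra.
have [zm|mz _] := ltP z m; last by move: mz; rewrite /z; lra.
have := phi_decr _ _ Iz Im zm; rewrite phim; lra.
Qed.

(** Write [u] as a convex combination of [m] and [v], with weight [a = (v - u) / (v - m)] on [m].
    Convexity gives [phi u - phi v <= a * (m - phi v)], and [m - phi v <= v - m] by
    [convex_involution_ge]. *)
Lemma convex_involution_contract (u v : R) : I v -> m < u -> u < v ->
  phi u - phi v <= v - u.
Proof.
move=> Iv mu uv; have vm : 0 < v - m by lra.
have := phi_convex ((v - u) / (v - m)) m v _ Im Iv.
have -> : (v - u) / (v - m) * m + (1 - (v - u) / (v - m)) * v = u.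
  by field; lra.
rewrite phim => /(_ _) h.
have {}h : phi u <= (v - u) / (v - m) * m + (1 - (v - u) / (v - m)) * phi v.
  by apply: h; rewrite divr_ge0 ?ler_pdivrMr //=; lra.
have hv := convex_involution_ge _ Iv.
have e : (v - u) / (v - m) * (v - m) = v - u by field; lra.
have d0 : 0 <= (v - u) / (v - m) by rewrite divr_ge0 //; lra.
by nra.
Qed.

End ConvexInvolution.

(** * Probabilities of rays as real numbers *)

Definition prob_below {R : realType} (P : distr R) (x : R) : R :=
  fine (P `]-oo, x]%classic).

(** The left limit of [prob_below]; keeping the two apart allows for atoms. *)
Definition prob_strictly_below {R : realType} (P : distr R) (x : R) : R :=
  fine (P `]-oo, x[%classic).

Section RayProbabilities.
Context {R : realType} (P : distr R).

Local Notation F := (prob_below P).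
Local Notation L := (prob_strictly_below P).

Lemma prob_setC_fine (A : set (measurableTypeR R)) : measurable A ->
  P (~` A) = (1 - fine (P A))%:E.
Proof.
by move=> mA; rewrite probability_setC // EFinB fineK // fin_num_measure.
Qed.

Lemma prob_le x : P `]-oo, x]%classic = (F x)%:E.
Proof. by rewrite fineK // fin_num_measure. Qed.

Lemma prob_lt x : P `]-oo, x[%classic = (L x)%:E.
Proof. by rewrite fineK // fin_num_measure. Qed.

Lemma prob_ge x : P `[x, +oo[%classic = (1 - L x)%:E.
Proof. by rewrite -setCitvl prob_setC_fine. Qed.

Lemma prob_gt x : P `]x, +oo[%classic = (1 - F x)%:E.
Proof. by rewrite -setCitvl prob_setC_fine. Qed.

Lemma prob_le_le x y : x <= y -> F x <= F y.
Proof.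
move=> xy; rewrite -lee_fin -!prob_le; apply: le_measure; rewrite ?inE //.
by apply: subset_itvl; rewrite bnd_simp.
Qed.

Lemma prob_lt_le x : L x <= F x.
Proof.
rewrite -lee_fin -prob_le -prob_lt; apply: le_measure; rewrite ?inE //.
by apply: subset_itvl; rewrite bnd_simp.
Qed.

Lemma prob_le_lt x y : x < y -> F x <= L y.
Proof.
move=> xy; rewrite -lee_fin -prob_le -prob_lt; apply: le_measure; rewrite ?inE //.
by apply: subset_itvl; rewrite bnd_simp.
Qed.

Lemma prob_oc x y : x <= y -> P `]x, y]%classic = (F y - F x)%:E.
Proof.
move=> xy; have := prob_le y.
have -> : `]-oo, y]%classic = `]-oo, x] `|` `]x, y] :> set R.
  by rewrite -itv_bndbnd_setU ?bnd_simp.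
rewrite measureU //; last first.
  by rewrite -subset0 => z [] /=; rewrite !in_itv /=; lra.
rewrite [X in (X + _)%E = _]prob_le addeC EFinB => <-; rewrite addeK //.
Qed.

Lemma prob_le_right_lb x y c : x < y ->
  (forall z, x < z < y -> c <= F z) -> c <= F x.
Proof.
move=> xy h; rewrite -lee_fin -prob_le.
have := @cdf_right_continuous _ _ _ P (idR : {RV P >-> R}) x => /cvg_lim e.
have -> : P `]-oo, x]%classic = cdf (idR : {RV P >-> R}) x by [].
rewrite -e //; apply: lime_ge; first by apply/cvgP; exact: cdf_right_continuous.
near=> z; have -> : cdf (idR : {RV P >-> R}) z = (F z)%:E by rewrite -prob_le.
rewrite lee_fin; apply: h; apply/andP; split; near: z;
  [exact: nbhs_right_gt|exact: nbhs_right_lt].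
Unshelve. all: by end_near. Qed.

End RayProbabilities.

(** * The reflection [phi] of a skewed distribution, its fixed point and the mean *)

Section SkewReflection.
Context {R : realType} (P : distr R) (I : set R).
Context (hI : supported_by P I).

Local Notation F := (prob_below P).
Local Notation L := (prob_strictly_below P).

Lemma prob_below_lt x y : I x -> I y -> x < y -> F x < L y.
Proof.
case: hI => itvI _ Finc Ix Iy xy; pose w := (x + y) / 2.
have xw : x < w by rewrite /w; lra.
have wy : w < y by rewrite /w; lra.
have Iw : I w by apply: (itvI _ _ Ix Iy); rewrite !ltW.
apply: lt_le_trans (prob_le_lt P w y wy).
have := Finc x w; rewrite !inE => /(_ Ix Iw xw).
by rewrite -lte_fin -!prob_le.
Qed.

Lemma prob_below_le_inv x y : I x -> I y -> F x <= F y -> x <= y.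
Proof.
move=> Ix Iy; rewrite leNgt => /negP Fxy; rewrite leNgt; apply/negP => yx.
by apply: Fxy; apply: lt_le_trans (prob_below_lt _ _ Iy Ix yx) (prob_lt_le P x).
Qed.

Lemma reflect_distr_fun x : distr_fun (reflect_distr P) (- x) = (1 - L x)%:E.
Proof.
rewrite -prob_ge; congr (P _); apply/seteqP; split => z /=;
  by rewrite !in_itv /= andbT /idR /oppR lerN2.
Qed.

(** The range inclusion in the skewness hypothesis makes [T (- x)] a genuine preimage, whence the
    first two properties; convexity survives the substitution of [- x], which is affine. *)
Lemma skewed_reflection : positively_skewed P I ->
  exists phi : R -> R,
    [/\ forall x, I x -> I (phi x), forall x, I x -> F (phi x) = 1 - L x
      & forall t x y, 0 <= t <= 1 -> I x -> I y ->
          phi (t * x + (1 - t) * y) <= t * phi x + (1 - t) * phi y].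
Proof.
case: hI => itvI _ Finc.
move=> [sub cvx]; pose T x := pinv I (distr_fun P) (distr_fun (reflect_distr P) x).
have imT x : I x -> (distr_fun P @` I) (distr_fun (reflect_distr P) (- x)).
  by move=> Ix; apply: sub; exists (- x) => //; exists x.
exists (fun x => T (- x)); split.
- move=> x Ix; rewrite /T; case: (imT x Ix) => y Iy <-.
  rewrite pinvKV ?inE // => u v Iu Iv uv.
  have [uv'|vu'|//] := ltgtP u v.
    by have := Finc u v Iu Iv uv'; rewrite uv ltxx.
  by have := Finc v u Iv Iu vu'; rewrite uv ltxx.
- move=> x Ix; apply: EFin_inj; rewrite -prob_le -reflect_distr_fun.
  have := @pinvK _ _ _ I (distr_fun P) (distr_fun (reflect_distr P) (- x)).
  by rewrite inE => h; exact: (h (fun=> point) (imT x Ix)).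
- move=> t x y t01 Ix Iy.
  pose t' := Itv01 (proj1 (andP t01)) (proj2 (andP t01)).
  have := cvx t' (- x) (- y).
  rewrite !inE => /(_ (ex_intro2 _ _ x Ix erefl) (ex_intro2 _ _ y Iy erefl)).
  have -> : conv t' (- x : convex_lmodType R^o) (- y : convex_lmodType R^o) =
      - (t * x + (1 - t) * y).
    by rewrite [LHS]convRE !mulrN -opprD.
  by rewrite [X in _ <= X]convRE.
Qed.

Lemma prob_strictly_below_eq0 x y : I y -> x <= y -> ~ I x -> L x = 0.
Proof.
case: hI => itvI PI _ Iy xy nIx; have mI := is_interval_measurable itvI.
apply/eqP; rewrite -eqe -prob_lt eq_le measure_ge0 andbT.
apply: (@le_trans _ _ (P (~` I))); last by rewrite probability_setC // PI subee.
apply: le_measure; rewrite ?inE //; first exact: measurableC.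
move=> z; rewrite /= in_itv /= => zx Iz; apply: nIx.
by apply: (itvI _ _ Iz Iy); rewrite xy ltW.
Qed.

Context (phi : R -> R) (phiI : forall x, I x -> I (phi x)).
Context (phiE : forall x, I x -> F (phi x) = 1 - L x).

(** [F (phi y) = 1 - L y < 1 - F x <= 1 - L x = F (phi x)]. *)
Lemma reflection_decr x y : I x -> I y -> x < y -> phi y < phi x.
Proof.
move=> Ix Iy xy; rewrite ltNge; apply/negP => /(prob_le_le P).
have := prob_below_lt _ _ Ix Iy xy; have := prob_lt_le P x.
by rewrite !phiE //; lra.
Qed.

Lemma reflectionK x : I x -> phi (phi x) = x.
Proof.
move=> Ix; have Ipx := phiI _ Ix; have Ippx := phiI _ Ipx.
have [itvI _ _] := hI.
apply/eqP; rewrite eq_le !leNgt; apply/andP; split; apply/negP => h.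
  (* For [z > x], [phi z < phi x] gives [P(X >= z) <= P(X < phi x)]; let [z]
     decrease to [x] using right continuity of [F]. *)
  suff : F (phi (phi x)) <= F x.
    by move/(prob_below_le_inv _ _ Ippx Ix); rewrite leNgt h.
  apply: (prob_le_right_lb _ _ _ _ h) => z /andP[xz zw].
  have Iz : I z by apply: (itvI _ _ Ix Ippx); rewrite !ltW.
  have := prob_le_lt P _ _ (reflection_decr _ _ Ix Iz xz).
  by have := prob_lt_le P z; rewrite !phiE //; lra.
(* Here [F (phi (phi x)) = 1 - L (phi x) >= 1 - F (phi x) = L x], against [phi (phi x) < x]. *)
have := prob_below_lt _ _ Ippx Ix h; have := prob_lt_le P (phi x).
by rewrite !phiE //; lra.
Qed.

Context (m : R) (Im : I m) (phim : phi m = m).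

(** At the fixed point [F m + L m = 1], while [L m <= F m]. *)
Lemma reflection_fixpoint_median : is_median P m.
Proof.
rewrite /is_median prob_le prob_ge !lee_fin -(phiE _ Im) phim.
by have := prob_lt_le P m; have := phiE _ Im; rewrite phim; split; lra.
Qed.

Context (phi_ge : forall x, I x -> 2 * m - x <= phi x).

Lemma reflection_tail_le t : 0 <= t -> L (m - t) <= 1 - F (m + t).
Proof.
move=> t0; have [Imt|nImt] := pselect (I (m - t)).
  have : F (m + t) <= F (phi (m - t)).
    by apply: prob_le_le; have := phi_ge _ Imt; lra.
  by rewrite phiE //; lra.
rewrite (prob_strictly_below_eq0 _ _ Im _ nImt); last lra.
by rewrite -lee_fin -prob_gt.
Qed.

Lemma reflection_fixpoint_le_mean m2 : has_finite_mean P m2 -> m <= m2.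
Proof.
move=> [intX EX].
have L1X : (idR : measurableTypeR R -> R) \in Lfun P 1.
  by rewrite inE; apply/Lfun1_integrable.
pose Y : {RV P >-> R} := ((idR : {RV P >-> R}) \- cst m)%R.
have L1Y : (Y : measurableTypeR R -> R) \in Lfun P 1.
  by rewrite rpredB // Lfun_cst.
have EY : ('E_P[Y] = (m2 - m)%:E)%E.
  by rewrite expectationB ?Lfun_cst // EX expectation_cst EFinB.
have EYpn : ('E_P[Y] = 'E_P[Y^\+%R] - 'E_P[Y^\-%R])%E.
  rewrite -[in LHS](funrposBneg Y) expectationB //.
  - exact/Lfun1_integrable/integrable_funrpos/Lfun1_integrable.
  - exact/Lfun1_integrable/integrable_funrneg/Lfun1_integrable.
have fin_neg : 'E_P[Y^\-%R]%E \is a fin_num.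
  apply: expectation_fin_num.
  exact/Lfun1_integrable/integrable_funrneg/Lfun1_integrable.
suff : (0 <= 'E_P[Y])%E by rewrite EY lee_fin subr_ge0.
rewrite EYpn sube_ge0 ?fin_neg ?orbT //.
(* The expectations of the positive and negative parts of [X - m] become integrals of their tails,
   which [reflection_tail_le] compares pointwise. *)
rewrite (@ge0_expectation_ccdf _ _ _ P Y^\+%R); last first.
  by move=> ?; exact: funrpos_ge0.
rewrite (@ge0_expectation_ccdf _ _ _ P Y^\-%R); last first.
  by move=> ?; exact: funrneg_ge0.
apply: ge0_le_integral => //.
- by apply: measurable_funTS; exact: ccdf_measurable.
- by apply: measurable_funTS; exact: ccdf_measurable.
move=> r /=; rewrite in_itv /= andbT => r0.
have -> : ccdf (Y^\-%R : {RV P >-> R}) r = (L (m - r))%:E.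
  rewrite -prob_lt; congr (P _); apply/seteqP; split => z /=;
    rewrite /funrneg /Y /idR /= !in_itv /= ?andbT lt_max; lra.
have -> : ccdf (Y^\+%R : {RV P >-> R}) r = (1 - F (m + r))%:E.
  rewrite -prob_gt; congr (P _); apply/seteqP; split => z /=;
    rewrite /funrpos /Y /idR /= !in_itv /= ?andbT lt_max; lra.
by rewrite lee_fin reflection_tail_le.
Qed.

End SkewReflection.

(** * Densities: masses of intervals, absence of atoms, local bounds *)

Lemma integral_cst_oc {R : realType} (c u v : R) : u <= v ->
  (\int[lebesgue_measure]_(x in `]u, v]%classic) (cst c%:E x) =
   (c * (v - u))%:E)%E.
Proof.
rewrite integral_cst //= lebesgue_measure_itv /= lte_fin le_eqVlt.
by move=> /predU1P[->|->]; rewrite ?ltxx ?subrr ?mulr0 ?mule0 // EFinM EFinB.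
Qed.

Section Density.
Context {R : realType} (P : distr R) (f : R -> R) (hf : is_density P f).

Local Notation F := (prob_below P).
Local Notation L := (prob_strictly_below P).

Let mEf (A : set (measurableTypeR R)) :
  measurable_fun A (fun z : measurableTypeR R => (f z)%:E).
Proof.
by case: hf => mf _ _; apply: measurable_funTS; exact/measurable_EFinP.
Qed.

Lemma density_lower_bound c u v : 0 <= c -> u <= v ->
  (forall z, u < z <= v -> c <= f z) -> c * (v - u) <= F v - F u.
Proof.
move=> c0 uv cf; case: (hf) => mf f0 Pf.
rewrite -lee_fin -prob_oc // Pf //.
rewrite -integral_cst_oc //.
apply: ge0_le_integral => //.
Qed.

Lemma density_upper_bound c u v : 0 <= c -> u <= v ->
  (forall z, u < z <= v -> f z <= c) -> F v - F u <= c * (v - u).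
Proof.
move=> c0 uv cf; case: (hf) => mf f0 Pf.
rewrite -lee_fin -prob_oc // Pf //.
rewrite -integral_cst_oc //.
apply: ge0_le_integral => //.
by move=> z _; rewrite lee_fin.
Qed.

Lemma density_no_atom x : L x = F x.
Proof.
case: (hf) => mf f0 Pf; apply: EFin_inj; rewrite -prob_le.
have -> : `]-oo, x]%classic = `]-oo, x[ `|` [set x] :> set R.
  by rewrite setUitv1.
rewrite measureU //; last first.
  by rewrite -subset0 => z [/= zx e]; move: zx; rewrite e in_itv /= ltxx.
by rewrite [X in (X + _)%E]prob_lt [X in (_ + X)%E]Pf // integral_set1 adde0.
Qed.

End Density.

(** Local upper bounds at a point of continuity; applied to [- f] it yields lower bounds. *)
Lemma within_continuous_ltr {R : realType} (I : set R) (f : R -> R) (x : R) :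
  {within I, continuous f} -> I x -> forall c, f x < c ->
  exists2 d, 0 < d & forall z, I z -> `|x - z| < d -> f z < c.
Proof.
move=> /subspace_continuousP cf Ix c fxc.
have : \forall z \near within I (nbhs x), f z < c.
  by apply: (cvgr_lt (f x)); [exact: cf|].
move=> /nbhs_ballP[d /= d0 h]; exists d => // z Iz xz; exact: h.
Qed.

(** * Comparison of the density at a point and at its reflection *)

Section ReflectedDensity.
Context {R : realType} (P : distr R) (I : set R) (hI : supported_by P I).
Context (f : R -> R) (hf : is_density P f) (cf : {within I, continuous f}).
Context (phi : R -> R) (phiI : forall x, I x -> I (phi x)).
Context (phiE : forall x, I x ->
  prob_below P (phi x) = 1 - prob_strictly_below P x).
Context (m : R) (Im : I m) (phi_contract : forall u v, I v -> m < u -> u < v ->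
  phi u - phi v <= v - u).

(** Otherwise, for [u] slightly left of [x], the mass of [(u, x]] is at least [c' * (x - u)], and
    that of [(phi x, phi u]] at most [c * (phi u - phi x) <= c * (x - u)] with [c < c']; yet the two
    masses agree. *)
Lemma density_reflection_le x : I x -> m < x -> f x <= f (phi x).
Proof.
have [itvI _ _] := hI; have [_ f0 _] := hf.
move=> Ix mx; rewrite leNgt; apply/negP => fyx.
set y := phi x in fyx; have Iy : I y by exact: phiI.
have fy0 := f0 y.
(* Cutting the gap into thirds gives [f y < c < c' < f x]. *)
pose c := f y + (f x - f y) / 3; pose c' := f x - (f x - f y) / 3.
have fyc : f y < c by rewrite /c; lra.
have [d d0 hd] := within_continuous_ltr _ _ _ cf Iy _ fyc.
have cf' : {within I, continuous (- f)}.
  by move=> z; apply: cvgN; exact: cf.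
have c'fx : (- f) x < - c' by rewrite /c' /= fctE; lra.
have [d' d'0 hd'] := within_continuous_ltr _ _ _ cf' Ix _ c'fx.
(* The first bound keeps [u = x - h] to the right of [m]; the others keep [(u, x]] within [d'] of
   [x] and, by [phi_contract], [(y, phi u]] within [d] of [y]. *)
pose h := Num.min ((x - m) / 2) (Num.min (d / 2) (d' / 2)).
have h0 : 0 < h by rewrite /h !lt_min !divr_gt0 ?subr_gt0.
have [hm hd2 hd'2] : [/\ h <= (x - m) / 2, h <= d / 2 & h <= d' / 2].
  by split; rewrite /h !ge_min lexx ?orbT.
pose u := x - h.
have mu : m < u by rewrite /u; lra.
have ux : u < x by rewrite /u; lra.
have Iu : I u by apply: (itvI _ _ Im Ix); rewrite !ltW.
have yu : y < phi u by exact: (reflection_decr P I hI phi phiE).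
have uy := phi_contract _ _ Ix mu ux.
have lb : c' * (x - u) <= prob_below P x - prob_below P u.
  apply: (density_lower_bound P f hf) => //; [by rewrite /c'; lra|exact: ltW|].
  move=> z /andP[uz zx]; have Iz : I z.
    by apply: (itvI _ _ Iu Ix); rewrite zx ltW.
  have := hd' _ Iz; rewrite /= fctE ger0_norm ?subr_ge0 // => /(_ _) hz.
  have {}hz : - f z < - c' by apply: hz; rewrite /u in uz; lra.
  lra.
have ub : prob_below P (phi u) - prob_below P y <= c * (phi u - y).
  apply: (density_upper_bound P f hf) => //; [by rewrite /c; lra|exact: ltW|].
  move=> z /andP[yz zu]; have Iz : I z.
    by apply: (itvI _ _ Iy (phiI _ Iu)); rewrite zu ltW.
  have := hd _ Iz; rewrite ltr0_norm ?subr_lt0 // => /(_ _) hz.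
  by apply/ltW/hz; rewrite /u /y in uy zu *; lra.
have e : prob_below P (phi u) - prob_below P y = prob_below P x - prob_below P u.
  by rewrite !phiE // !(density_no_atom _ _ hf); lra.
have c0 : 0 <= c by rewrite /c; lra.
have cc' : c < c' by rewrite /c /c'; lra.
rewrite -/y in uy.
by nra.
Qed.

End ReflectedDensity.

Theorem theorem12 (R : realType) (P : distr R) (I : set R)
    (hI : supported_by P I) (hskew : positively_skewed P I) :
  [/\ (forall m0 : R, unimodal_with_mode P I m0 ->
         exists m1 : R, is_median P m1 /\ m0 <= m1),
      (forall m2 : R, has_finite_mean P m2 ->
         exists m1 : R, is_median P m1 /\ m1 <= m2)
    & (forall m3 : R, uniantimodal_with_antimode P I m3 ->
         exists m1 : R, is_median P m1 /\ m1 <= m3)].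
Proof.
have [itvI PI _] := hI.
have [phi [phiI phiE phi_convex]] := skewed_reflection P I hI hskew.
have phi_decr := reflection_decr P I hI phi phiE.
have phiK := reflectionK P I hI phi phiI phiE.
have I0 : I !=set0.
  apply/set0P/eqP => I0; move: PI; rewrite I0 measure0 => /esym/eqP.
  by rewrite onee_eq0.
have [m [Im phim]] := decreasing_involution_fixpoint I phi itvI phiI phi_decr phiK I0.
have phi_ge := convex_involution_ge I phi itvI phiI phi_decr phiK phi_convex m Im phim.
have phi_contract :=
  convex_involution_contract I phi itvI phiI phi_decr phiK phi_convex m Im phim.
have med := reflection_fixpoint_median P I phi phiE m Im phim.
split.
(* If [m < m0], then [phi m0] is a maximizer too, so [phi m0 = m0] by uniqueness, although
   [phi m0 < phi m = m]. *)
- move=> m0 [f [hf cf maxf]]; exists m; split => //.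
  have [Im0 f_le] : maximizers I f m0 by rewrite maxf.
  rewrite leNgt; apply/negP => mm0.
  have fm0 := density_reflection_le P I hI f hf cf phi phiI phiE m Im phi_contract _ Im0 mm0.
  have : maximizers I f (phi m0).
    by split=> [|x Ix]; [exact: phiI|exact: le_trans (f_le _ Ix) fm0].
  rewrite maxf /= => pm0.
  have := phi_decr _ _ Im Im0 mm0; rewrite phim pm0; lra.
- move=> m2 hm2; exists m; split => //.
  exact: (reflection_fixpoint_le_mean P I hI phi phiE m Im phi_ge).
(* If [m3 < m], the comparison at [phi m3 > m] reads [f (phi m3) <= f m3], so [phi m3] is a second
   minimizer. *)
- move=> m3 [f [hf cf minf]]; exists m; split => //.
  have [Im3 f_ge] : minimizers I f m3 by rewrite minf.
  rewrite leNgt; apply/negP => m3m.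
  have mpm3 : m < phi m3 by rewrite -phim; exact: phi_decr.
  have := density_reflection_le P I hI f hf cf phi phiI phiE m Im phi_contract _
    (phiI _ Im3) mpm3; rewrite phiK // => fm3.
  have : minimizers I f (phi m3).
    by split=> [|x Ix]; [exact: phiI|exact: le_trans fm3 (f_ge _ Ix)].
  by rewrite minf /= => pm3; have := lt_trans m3m mpm3; rewrite pm3 ltxx.
Qed.
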